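(* Even in unit capacity markets there exist rank-minimizing mechanisms (without full support) that are obviously manipulable; that is, there exist a unit capacity market (a finite set $I$ of $N$ agents and a set $O$ of $N$ objects, each of capacity $1$) and a rank-minimizing mechanism $\psi$ for this market, not having full support, such that $\psi$ is obviously manipulable.
   Context: Preferences: each agent $i\in I$ has a strict preference relation (type) $\succ_i$, a strict linear ranking of $O$; $\mathcal P^I$ is the set of all profiles $\succ_I=(\succ_i,\succ_{-i})$ of strict rankings. Write $o\succsim_i o'$ if $o\succ_i o'$ or $o=o'$. The rank of $o$ for an agent with preference $\succ_i$ is $r_i(o)=|\{o'\in O: o'\succsim_i o\}|$ (favorite object has rank 1). Allocations: an allocation is a function $\alpha:I\to O$, $i\mapsto\alpha_i$, assigning each object to at most as many agents as its capacity (here $1$). $\mathcal A$ is the set of all allocations. A random allocation is a probability distribution $\mu$ on $\mathcal A$; $\mathcal M$ is the set of these; $\mathrm{supp}(\mu)=\{\alpha\in\mathcal A:\mu(\alpha)>0\}$. Rank minimization: at a profile $\succ_I$, the average rank of $\alpha$ is $\bar r(\alpha)=\frac1N\sum_{i\in I}r_i(\alpha_i)$, and $\bar{\mathcal A}(\succ_I)=\{\alpha\in\mathcal A:\bar r(\alpha)\le\bar r(\alpha')\ \forall\alpha'\in\mathcal A\}$. Mechanisms: a mechanism is a function $\psi:\mathcal P^I\to\mathcal M$. It is rank-minimizing if $\mathrm{supp}(\psi(\succ_I))\subseteq\bar{\mathcal A}(\succ_I)$ for all $\succ_I$; a rank-minimizing mechanism has full support if $\psi(\succ_I)(\alpha)>0$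 for all $\alpha\in\bar{\mathcal A}(\succ_I)$ and all $\succ_I$. Obvious manipulability: for an agent $i$ with true type $\succ_i$ and a random allocation $\mu$, let $\bar\rho_i(\mu)=\max_{\alpha\in\mathrm{supp}(\mu)}r_i(\alpha_i)$ and $\underline\rho_i(\mu)=\min_{\alpha\in\mathrm{supp}(\mu)}r_i(\alpha_i)$, where $r_i$ is always computed with the true type $\succ_i$. A mechanism $\psi$ is not obviously manipulable if for every agent $i$, every type $\succ_i$ and every $\succ_i'\ne\succ_i$: (i) $\max_{\succ_{-i}}\bar\rho_i(\psi(\succ_i,\succ_{-i}))\le\max_{\succ_{-i}}\bar\rho_i(\psi(\succ_i',\succ_{-i}))$, and (ii) $\min_{\succ_{-i}}\underline\rho_i(\psi(\succ_i,\succ_{-i}))\le\min_{\succ_{-i}}\underline\rho_i(\psi(\succ_i',\succ_{-i}))$. Otherwise $\psi$ is obviously manipulable. *)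

(* Defs.v *)
From HB Require Import structures.
From mathcomp Require Import all_boot all_order all_algebra.
From mathcomp Require Import reals.

Set Implicit Arguments.
Unset Strict Implicit.
Unset Printing Implicit Defensive.

Import Order.TTheory GRing.Theory Num.Theory.
Local Open Scope ring_scope.

Section Preferences.
Variable O : finType.

Definition strict_linear (r : {ffun O * O -> bool}) : bool :=
  [&& [forall x, ~~ r (x, x)],
      [forall x, forall y, forall z, r (x, y) && r (y, z) ==> r (x, z)]
    & [forall x, forall y, (x != y) ==> r (x, y) || r (y, x)]].

(* Relations are stored as finite functions so that preferences form a finType,
   and the maxima and minima over profiles are over finite sets. *)
Record pref := Pref {
  pref_rel : {ffun O * O -> bool};
  pref_relP : strict_linear pref_rel }.

HB.instance Definition _ := [isSub for pref_rel].
HB.instance Definition _ := [Finite of pref by <:].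

Definition prefers (s : pref) (x y : O) : bool := pref_rel s (x, y).

Definition weakly_prefers (s : pref) (x y : O) : bool :=
  prefers s x y || (x == y).

Definition rank (s : pref) (o : O) : nat :=
  #|[set o' | weakly_prefers s o' o]|.

Lemma rank_le_card s o : (rank s o <= #|O|)%N.
Proof. exact: max_card. Qed.

End Preferences.

Section Market.
Variables (R : realType) (I O : finType).

Definition feasible (f : {ffun I -> O}) : bool :=
  [forall o, (#|[set i | f i == o]| <= 1)%N].

Record alloc := Alloc {
  alloc_fun :> {ffun I -> O};
  alloc_funP : feasible alloc_fun }.

HB.instance Definition _ := [isSub for alloc_fun].
HB.instance Definition _ := [Finite of alloc by <:].

Record random_alloc := RandomAlloc {
  prob_of :> {ffun alloc -> R};
  prob_of_ge0 : forall a, 0 <= prob_of a;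
  prob_of_sum1 : \sum_a prob_of a = 1 }.

Definition supp (mu : random_alloc) : {set alloc} := [set a | 0 < mu a].

Lemma supp_neq0 (mu : random_alloc) : supp mu != set0.
Proof.
apply/negP => /eqP supp0; have := prob_of_sum1 mu.
rewrite big1 => [|a _]; first by move/esym/eqP; rewrite oner_eq0.
apply/eqP; rewrite eq_le prob_of_ge0 andbT leNgt.
by have := in_set0 a; rewrite -supp0 inE => ->.
Qed.

Definition profile := {ffun I -> pref O}.

Definition avg_rank (p : profile) (a : alloc) : rat :=
  (#|I|%:R)^-1 * \sum_(i : I) (rank (p i) (a i))%:R.

Definition rank_min_allocs (p : profile) : {set alloc} :=
  [set a | [forall a' : alloc, avg_rank p a <= avg_rank p a']].

Definition mechanism := profile -> random_alloc.

Definition rank_minimizing (psi : mechanism) : Prop :=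
  forall p : profile, supp (psi p) \subset rank_min_allocs p.

Definition full_support (psi : mechanism) : Prop :=
  forall (p : profile) (a : alloc), a \in rank_min_allocs p -> 0 < psi p a.

Definition max_rank (s : pref O) (i : I) (mu : random_alloc) : nat :=
  \max_(a in supp mu) rank s (a i).

(* Supports are nonempty and ranks are at most #|O|, so starting the iterated
   minimum at #|O| does not change it. *)
Definition min_rank (s : pref O) (i : I) (mu : random_alloc) : nat :=
  \big[minn/#|O|]_(a in supp mu) rank s (a i).

(* The profiles of the other agents are enumerated as the full profiles p whose
   i-th component is the given report t; s is the true type of i. *)
Definition worst_case (psi : mechanism) (i : I) (s t : pref O) : nat :=
  \max_(p : profile | p i == t) max_rank s i (psi p).

Definition best_case (psi : mechanism) (i : I) (s t : pref O) : nat :=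
  \big[minn/#|O|]_(p : profile | p i == t) min_rank s i (psi p).

Definition not_obviously_manipulable (psi : mechanism) : Prop :=
  forall (i : I) (s s' : pref O), s' != s ->
    (worst_case psi i s s <= worst_case psi i s s')%N /\
    (best_case psi i s s <= best_case psi i s s')%N.

Definition obviously_manipulable (psi : mechanism) : Prop :=
  ~ not_obviously_manipulable psi.

End Market.

(* Main.v *)
(** In a market with three agents and objects 0, 1, 2, let agent 0 have true
    type [0 > 1 > 2].  When every agent has this type, all allocations have the
    same average rank, so the mechanism may give agent 0 object 2.  When agent 0
    reports [1 > 0 > 2], some rank-minimizing allocation never gives it object 2:
    an agent holding its last reported object can swap with the holder of its
    first, gaining two ranks while the other agent loses at most two.  Breaking
    ties this way, the misreport lowers the worst-case rank from 3 to at most 2. *)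
Require Import Defs.
From mathcomp Require Import all_boot all_order all_algebra.
From mathcomp Require Import all_fingroup.
From mathcomp Require Import reals.

Set Implicit Arguments.
Unset Strict Implicit.
Unset Printing Implicit Defensive.

Import Order.TTheory GRing.Theory Num.Theory.
Local Open Scope ring_scope.

Section PermPref.
Variable n : nat.
Implicit Types (u : {perm 'I_n}) (x y o : 'I_n).

Lemma perm_rel_linear u :
  strict_linear [ffun xy : 'I_n * 'I_n => (u xy.1 < u xy.2)%N].
Proof.
apply/and3P; split.
- by apply/forallP => x; rewrite ffunE ltnn.
- apply/forallP => x; apply/forallP => y; apply/forallP => z.
  by rewrite !ffunE; apply/implyP => /andP[]; apply: ltn_trans.
- apply/forallP => x; apply/forallP => y; rewrite !ffunE -neq_ltn /=.
  by apply/implyP; apply: contraNneq => /val_inj/perm_inj->.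
Qed.

(** [u o] is the position of [o] in the ranking, counted from 0. *)
Definition perm_pref u : pref 'I_n := Pref (perm_rel_linear u).

Lemma prefers_perm_pref u x y : prefers (perm_pref u) x y = (u x < u y)%N.
Proof. by rewrite /prefers /= ffunE. Qed.

(** The objects weakly preferred to [o] form the preimage under [u] of the positions up to [u o].
    The successor appears because positions start at 0 and ranks at 1. *)
Lemma rank_perm_pref u o : rank (perm_pref u) o = (u o).+1.
Proof.
have -> : rank (perm_pref u) o = #|u @^-1: [set k : 'I_n | (k < (u o).+1)%N]|.
  rewrite /rank; apply: eq_card => x; rewrite !inE /weakly_prefers.
  by rewrite prefers_perm_pref -(inj_eq (@perm_inj _ u)) ltnS orbC [RHS]leq_eqVlt.
rewrite card_preimset; last exact: perm_inj.
by rewrite cardsE -sum1_card (big_ord_narrow (ltn_ord (u o))) sum1_card card_ord.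
Qed.

End PermPref.

Lemma rank_gt0 (O : finType) (s : pref O) (o : O) : (0 < rank s o)%N.
Proof.
by apply/card_gt0P; exists o; rewrite inE /weakly_prefers eqxx orbT.
Qed.

Section Allocations.
Variables I O : finType.
Implicit Types (p : profile I O) (a b : alloc I O).

Lemma feasibleP (f : {ffun I -> O}) : reflect (injective f) (feasible f).
Proof.
apply: (iffP forallP) => [inj i j fij | inj o].
  have /card_le1_eqP := inj (f j); apply; rewrite inE ?fij; exact: eqxx.
by apply/card_le1_eqP => i j; rewrite !inE => /eqP <- /eqP /inj.
Qed.

Lemma alloc_inj a : injective a.
Proof. exact/feasibleP/alloc_funP. Qed.

Lemma alloc_bij a : #|I| = #|O| -> bijective a.
Proof. by move=> IO; apply: inj_card_bij (@alloc_inj a) _; rewrite IO. Qed.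

Lemma permuted_alloc_feasible (u : {perm O}) a : feasible [ffun i => u (a i)].
Proof. by apply/feasibleP => i j; rewrite !ffunE => /perm_inj/alloc_inj. Qed.

Definition permute_alloc (u : {perm O}) a := Alloc (permuted_alloc_feasible u a).

Lemma permute_allocE u a i : permute_alloc u a i = u (a i).
Proof. by rewrite ffunE. Qed.

Definition total_rank p a : nat := \sum_i rank (p i) (a i).

Lemma avg_rank_le p a b : (0 < #|I|)%N ->
  (avg_rank p a <= avg_rank p b) = (total_rank p a <= total_rank p b)%N.
Proof.
move=> I0; rewrite /avg_rank ler_pM2l ?invr_gt0 ?ltr0n //.
by rewrite -!natr_sum ler_nat.
Qed.

Lemma rank_min_allocsP p a : (0 < #|I|)%N ->
  reflect (forall b, (total_rank p a <= total_rank p b)%N)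
          (a \in rank_min_allocs p).
Proof.
move=> I0; rewrite inE; apply: (iffP forallP) => H b; move: (H b);
  by rewrite avg_rank_le.
Qed.

(** With equally many agents and objects an allocation is a bijection, so the sum over agents
    reindexes to one over objects. Hence all allocations tie when the types agree. *)
Lemma total_rank_const (s : pref O) a : #|I| = #|O| ->
  total_rank [ffun=> s] a = \sum_o rank s o.
Proof.
move=> IO; rewrite [RHS](reindex a) /=; last exact/onW_bij/alloc_bij.
by apply: eq_bigr => i _; rewrite ffunE.
Qed.

Lemma rank_min_avoids_last p a i (top bot : O) : #|I| = #|O| ->
    rank (p i) top = 1%N -> rank (p i) bot = #|O| -> top != bot ->
    a \in rank_min_allocs p ->
  exists2 b, b \in rank_min_allocs p & b i != bot.
Proof.
move=> IO r_top r_bot tb a_min; have I0 : (0 < #|I|)%N by apply/card_gt0P; exists i.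
have [ai|] := eqVneq (a i) bot; last by exists a.
have [g _ ag] := alloc_bij a IO; set j := g top; have aj : a j = top := ag top.
have ji : j != i by apply: contraNneq tb => e; rewrite -aj -ai e.
exists (permute_alloc (tperm top bot) a); last by rewrite permute_allocE ai tpermR.
apply/rank_min_allocsP => // b.
apply: leq_trans (_ : total_rank p a <= _)%N; last exact/rank_min_allocsP.
have split_total c : total_rank p c = (rank (p i) (c i) + rank (p j) (c j)
    + \sum_(k | (k != i) && (k != j)) rank (p k) (c k))%N.
  by rewrite /total_rank (bigD1 i) //= (bigD1 j) //= addnA.
rewrite !split_total !permute_allocE ai aj tpermL tpermR r_top r_bot.
(* By injectivity of [a], the agents other than [i] and [j] hold neither [top] nor [bot], so the
   swap leaves their ranks unchanged. *)
rewrite leq_add //; last first.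
  apply: eq_leq; apply: eq_bigr => k /andP[ki kj]; rewrite permute_allocE tpermD //.
    by apply: contraNneq kj; rewrite -aj => /alloc_inj->.
  by apply: contraNneq ki; rewrite -ai => /alloc_inj->.
(* What remains is [1 + rank (p j) bot <= #|O| + rank (p j) top], which follows from the extreme
   values a rank can take. *)
by rewrite addnC leq_add ?rank_le_card ?rank_gt0.
Qed.

Lemma rank_min_exists p a : (0 < #|I|)%N -> exists b, b \in rank_min_allocs p.
Proof.
move=> I0; case: (@arg_minnP _ a xpredT (total_rank p) isT).
by move=> b _ b_min; exists b; apply/rank_min_allocsP => // c; apply: b_min.
Qed.

(** Tie-breaking: at each profile select a minimizer satisfying [good] if there is one, and an
    arbitrary minimizer otherwise. The allocation [a] only ensures that minimizers exist. *)
Lemma rank_min_choice (good : profile I O -> pred (alloc I O)) a :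
    (0 < #|I|)%N ->
  exists choice : profile I O -> alloc I O,
    (forall p, choice p \in rank_min_allocs p) /\
    (forall p b, b \in rank_min_allocs p -> good p b -> good p (choice p)).
Proof.
move=> I0; pose m p := xchoose (rank_min_exists p a I0).
exists (fun p => odflt (m p) [pick b in rank_min_allocs p | good p b]).
split=> [p|p b b_min b_good]; case: pickP => [c /andP[] //|none] /=.
  exact: xchooseP.
by have := none b; rewrite /= b_min b_good.
Qed.

End Allocations.

Section PointMass.
Variables (R : realType) (I O : finType).

Definition point_mass (a : alloc I O) : {ffun alloc I O -> R} :=
  [ffun b => (b == a)%:R].

Lemma point_mass_ge0 a b : 0 <= point_mass a b.
Proof. by rewrite ffunE ler0n. Qed.

Lemma point_mass_sum1 a : \sum_b point_mass a b = 1.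
Proof.
rewrite (bigD1 a) //= big1 => [|b ba]; last by rewrite ffunE (negPf ba).
by rewrite ffunE eqxx addr0.
Qed.

Definition degenerate a : random_alloc R I O :=
  RandomAlloc (point_mass_ge0 a) (point_mass_sum1 a).

Lemma degenerate_gt0 a b : (0 < degenerate a b) = (b == a).
Proof. by rewrite /= ffunE ltr0n; case: eqP. Qed.

Lemma supp_degenerate a : supp (degenerate a) = [set a].
Proof. by apply/setP => b; rewrite !inE degenerate_gt0. Qed.

Lemma max_rank_degenerate s i a : max_rank s i (degenerate a) = rank s (a i).
Proof. by rewrite /max_rank supp_degenerate big_set1. Qed.

End PointMass.

Theorem proposition4 (R : realType) :
  exists (N : nat) (I O : finType),
    [/\ #|I| = N, #|O| = N &
      exists psi : mechanism R I O,
        [/\ rank_minimizing psi, ~ full_support psi & obviously_manipulable psi]].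
Proof.
exists 3, 'I_3, 'I_3; split; rewrite ?card_ord //.
pose o0 : 'I_3 := inord 0; pose o1 : 'I_3 := inord 1; pose o2 : 'I_3 := inord 2.
have o01 : o0 != o1 by rewrite -val_eqE /= !inordK.
have o12 : o1 != o2 by rewrite -val_eqE /= !inordK.
have o02 : o0 != o2 by rewrite -val_eqE /= !inordK.
(* [s] is the true type and [t] the misreport, which exchanges the first two positions. *)
pose s := perm_pref (1%g : 'S_3); pose t := perm_pref (tperm o0 o1).
have ts : t != s.
  apply/eqP => /(congr1 (fun r => prefers r o0 o1)).
  by rewrite !prefers_perm_pref tpermL tpermR !perm1 !inordK.
have id_feasible : feasible [ffun i : 'I_3 => i].
  by apply/feasibleP => i j; rewrite !ffunE.
pose a0 : alloc 'I_3 'I_3 := Alloc id_feasible.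
have I0 : (0 < #|'I_3|)%N by rewrite card_ord.
pose ps : profile 'I_3 'I_3 := [ffun=> s].
have const_min a : a \in rank_min_allocs ps.
  by apply/(rank_min_allocsP _ _ I0) => b; rewrite !total_rank_const.
(* One predicate for both tie-breaking aims: agent 0 gets object 2 exactly when it reports [s]. *)
pose good (p : profile 'I_3 'I_3) (a : alloc 'I_3 'I_3) :=
  (a o0 == o2) == (p o0 == s).
have [choice [choice_min choice_good]] := rank_min_choice good a0 I0.
exists (fun p => degenerate R (choice p)); split.
- by move=> p; rewrite supp_degenerate sub1set.
- move=> full.
  (* At [ps] every allocation is minimizing, so full support would make them all equal to the single
     chosen one. *)
  have chosen a : a = choice ps.
    by apply/eqP; rewrite -(degenerate_gt0 R) full.
  have := chosen a0; rewrite -(chosen (permute_alloc (tperm o0 o1) a0)).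
  move/(congr1 (fun a : alloc _ _ => a o0)); rewrite permute_allocE /= ffunE.
  by rewrite tpermL => /eqP; rewrite (negPf o01).
- move=> /(_ o0 s t ts)[+ _]; apply/negP; rewrite -ltnNge.
  (* Condition (i) fails, with 2 separating the two worst cases: reporting [t] never yields more,
     while reporting [s] yields 3 at [ps]. *)
  apply: (@leq_ltn_trans 2).
    apply/bigmax_leqP => p /eqP pt; rewrite max_rank_degenerate.
    have rank_bot : rank (p o0) o2 = #|'I_3|.
      by rewrite pt rank_perm_pref tpermD // inordK // card_ord.
    have rank_top : rank (p o0) o1 = 1%N.
      by rewrite pt rank_perm_pref tpermR inordK.
    have [b b_min bo] :=
      rank_min_avoids_last (erefl _) rank_top rank_bot o12 (choice_min p).
    have := choice_good p b b_min; rewrite /good pt (negPf ts) (negPf bo).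
    move/(_ isT)/eqP/negbT; rewrite -val_eqE /= inordK // rank_perm_pref perm1.
    by case: (choice p o0) => [[|[|[]]]].
  apply: (@leq_trans (rank s o2)); first by rewrite rank_perm_pref perm1 inordK.
  rewrite /worst_case (bigD1 ps) /=; last by rewrite ffunE.
  apply: leq_trans (leq_maxl _ _); rewrite max_rank_degenerate.
  (* Exchanging objects 0 and 2 in the identity allocation gives a good minimizer at [ps], so the
     choice there must give agent 0 object 2. *)
  have := choice_good ps (permute_alloc (tperm o0 o2) a0) (const_min _).
  rewrite /good permute_allocE /= !ffunE tpermL !eqxx => /(_ isT).
  by move/eqP/eqP ->.
Qed.
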